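(* Let $f$ be a $(\lambda,p)$-decomposable function on $[a,b]$ for some $\lambda\in\Lambda[a,b]$ and $1\le p<2$. If $(g,h)\in D^+_{\lambda,p}(f)\cup D^-_{\lambda,p}(f)\ne\emptyset$, then $f$ has the quadratic $\lambda$-variation, and its bracket function is given by $$[f]_\lambda(x)=[g]^c_\lambda(x)+\sum_{(a,x]}\{\Delta^-f\}^2+\sum_{[a,x)}\{\Delta^+f\}^2,\qquad a\le x\le b.$$
   Context: Fix real $a<b$. A function $f:[a,b]\to\mathbb R$ is regulated if the finite limits $f(t-)$, $t\in(a,b]$, and $f(s+)$, $s\in[a,b)$, exist; $\Delta^-f(t)=f(t)-f(t-)$ and $\Delta^+f(s)=f(s+)-f(s)$. $\Lambda[a,b]$ is the set of sequences $\lambda=\{\lambda_m:m\ge1\}$ of partitions (finite sets $a=t_0<\dots<t_n=b$) of $[a,b]$ with $\lambda_m\subset\lambda_{m+1}$ and $\cup\lambda:=\bigcup_m\lambda_m$ dense in $[a,b]$. For $a\le s<t\le b$ let $\lambda_m|_{[s,t]}=\{s,t\}\cup(\lambda_m\cap(s,t))=\{s=x_0<\dots<x_n=t\}$. A regulated $f$ has the quadratic $\lambda$-variation on $[a,b]$, written $f\in Q_\lambda[a,b]$, if there is a regulated $V$ with $V(a)=0$ and, for all $a\le s<t\le b$, $V(t)-V(s)=\lim_{m\to\infty}\sum_i[f(x_i)-f(x_{i-1})]^2$ (sum over $\lambda_m|_{[s,t]}$), $\Delta^-V(t)=(\Delta^-f(t))^2$, $\Delta^+V(s)=(\Delta^+f(s))^2$.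 Then $[f]_\lambda:=V$ is the bracket function, and $[f]^c_\lambda(t)=[f]_\lambda(t)-\sum_{(a,t]}(\Delta^-f)^2-\sum_{[a,t)}(\Delta^+f)^2$. For $0<p<\infty$, $v_p(f;[a,b])=\sup\sum_i|f(t_i)-f(t_{i-1})|^p$ over all partitions of $[a,b]$, and $\mathcal W_p[a,b]=\{f:v_p(f;[a,b])<\infty\}$. $\mathrm{dual}(\mathcal W_1)[a,b]$ is the set of all regulated functions on $[a,b]$; for $1<p<\infty$, $\mathrm{dual}(\mathcal W_p)[a,b]=\bigcup\{\mathcal W_q[a,b]:\tfrac1p+\tfrac1q>1\}$. A regulated $f$ is $(\lambda,p)$-decomposable if there is a pair $(g,h)$ of regulated functions with $g\in Q_\lambda[a,b]\cap\mathrm{dual}(\mathcal W_p)[a,b]$, $h\in\mathcal W_p[a,b]$, $g(a)=h(a)=0$ and $f\equiv C+g+h$ for some constant $C$; $D_{\lambda,p}(f)$ is the set of all such pairs. $D^+_{\lambda,p}(f)$ is the set of $(g,h)\in D_{\lambda,p}(f)$ with $\{t\in(a,b):\Delta^+g(t)\ne0\}\cup\{t\in(a,b):\Delta^+h(t)\ne0\}\subset\cup\lambda$; $D^-_{\lambda,p}(f)$ is defined in the same way with $\Delta^-$ in place of $\Delta^+$. *)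

(* Defs.v *)
From HB Require Import structures.
From mathcomp Require Import all_boot all_order all_algebra.
From mathcomp Require Import all_classical all_reals all_analysis.
Import Order.TTheory GRing.Theory Num.Theory.
Import numFieldNormedType.Exports.

Set Implicit Arguments.
Unset Strict Implicit.
Unset Printing Implicit Defensive.

Local Open Scope classical_set_scope.
Local Open Scope ring_scope.

(* A function on [a, b] is a total function R -> R of which only the values on
   [a, b] are used; the one-sided limits below are only taken at points, and
   from sides, for which they depend on the values on [a, b] alone.

   As in [itv_partition], a partition a = t_0 < ... < t_n = b is represented by
   the sequence [:: t_1; ...; t_n]; its set of points is a :: [:: t_1; ...; t_n].
   Sequences of partitions are indexed from 0. *)

Section Defs.
Context {R : realType}.
Implicit Types (a b p s t x : R) (f V : R -> R) (lambda : nat -> seq R).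

Definition llim f t : R := lim (f u @[u --> t^'-]).
Definition rlim f s : R := lim (f u @[u --> s^'+]).

Definition jumpl f t : R := f t - llim f t.
Definition jumpr f s : R := rlim f s - f s.

Definition regulated a b f : Prop :=
  (forall t, a < t <= b -> cvg (f u @[u --> t^'-])) /\
  (forall s, a <= s < b -> cvg (f u @[u --> s^'+])).

Definition points lambda a : set R :=
  [set x | exists m, x \in a :: lambda m].

Definition Lambda a b : set (nat -> seq R) :=
  [set lambda | [/\ forall m, itv_partition a b (lambda m),
      forall m, {subset a :: lambda m <= a :: lambda m.+1} &
      `[a, b] `<=` closure (points lambda a)]].

(* {s, t} together with the points of r in (s, t), as a partition of [s, t] *)
Definition restr_partition (r : seq R) s t : seq R :=
  rcons [seq x <- r | s < x < t] t.

Definition quadratic_sum s t f (r : seq R) : R :=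
  let F := f \o nth t (s :: r) in
  \sum_(0 <= i < size r) (F i.+1 - F i) ^+ 2.

Definition is_bracket a b lambda f V : Prop :=
  [/\ regulated a b V, V a = 0,
      forall s t, a <= s -> s < t -> t <= b ->
        quadratic_sum s t f (restr_partition (lambda m) s t) @[m --> \oo]
          --> V t - V s,
      forall t, a < t <= b -> jumpl V t = jumpl f t ^+ 2 &
      forall s, a <= s < b -> jumpr V s = jumpr f s ^+ 2].

Definition Qvar a b lambda : set (R -> R) :=
  [set f | regulated a b f /\ exists V, is_bracket a b lambda f V].

(* Well defined on [a, b], see bracketE; only meaningful for f in Qvar. *)
Definition bracket a b lambda f : R -> R :=
  xget (fun=> 0) [set V | is_bracket a b lambda f V].

(* [esum] is the supremum of the finite partial sums, valued in \bar R; the two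
   sums are finite whenever f is in Qvar and a <= x <= b. *)
Definition sum_jumpl_sqr f a x : \bar R :=
  (\esum_(t in `]a, x]) ((jumpl f t ^+ 2)%:E))%E.

Definition sum_jumpr_sqr f a x : \bar R :=
  (\esum_(s in `[a, x[) ((jumpr f s ^+ 2)%:E))%E.

Definition bracket_cont a b lambda f x : \bar R :=
  ((bracket a b lambda f x)%:E - sum_jumpl_sqr f a x - sum_jumpr_sqr f a x)%E.

Definition power_sum p a b f (r : seq R) : R :=
  let F := f \o nth b (a :: r) in
  \sum_(0 <= i < size r) `|F i.+1 - F i| `^ p.

Definition pvariation p a b f : \bar R :=
  ereal_sup [set (power_sum p a b f r)%:E | r in itv_partition a b].

Definition Wp p a b : set (R -> R) :=
  [set f | (pvariation p a b f < +oo)%E].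

(* Only used for 1 <= p *)
Definition dualW p a b : set (R -> R) :=
  [set f | (p = 1 /\ regulated a b f) \/
           (1 < p /\ exists q : R, [/\ 0 < q, 1 < p^-1 + q^-1 & Wp q a b f])].

Definition Dpairs a b lambda p f : set ((R -> R) * (R -> R)) :=
  [set gh | let: (g, h) := gh in
    [/\ regulated a b g /\ regulated a b h,
        Qvar a b lambda g /\ dualW p a b g,
        Wp p a b h,
        g a = 0 /\ h a = 0 &
        exists C : R, forall t, a <= t <= b -> f t = C + g t + h t]].

Definition decomposable a b lambda p f : Prop :=
  regulated a b f /\ Dpairs a b lambda p f !=set0.

Definition Dplus a b lambda p f : set ((R -> R) * (R -> R)) :=
  [set gh | Dpairs a b lambda p f gh /\
    [set t | a < t < b /\ jumpr gh.1 t != 0] `|`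
    [set t | a < t < b /\ jumpr gh.2 t != 0] `<=` points lambda a].

Definition Dminus a b lambda p f : set ((R -> R) * (R -> R)) :=
  [set gh | Dpairs a b lambda p f gh /\
    [set t | a < t < b /\ jumpl gh.1 t != 0] `|`
    [set t | a < t < b /\ jumpl gh.2 t != 0] `<=` points lambda a].

Lemma bracketE a b lambda f V x : is_bracket a b lambda f V ->
  a <= x <= b -> bracket a b lambda f x = V x.
Proof.
move=> fV /andP[ax xb].
have [_ W0 WE _ _] : is_bracket a b lambda f (bracket a b lambda f).
  exact: (@xgetPex _ _ [set V | is_bracket a b lambda f V] (ex_intro _ V fV)).
have [_ V0 VE _ _] := fV.
move: ax; rewrite le_eqVlt => /predU1P[<-|ax]; first by rewrite W0 V0.
have := cvg_unique _ (WE a x (lexx a) ax xb) (VE a x (lexx a) ax xb).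
by rewrite W0 V0 !subr0 => ->.
Qed.

End Defs.

(* Main.v *)
Require Import Defs.
From mathcomp Require Import all_boot all_order all_algebra.
From mathcomp Require Import all_classical all_reals all_analysis.
From mathcomp Require Import ring lra.
Import Order.TTheory GRing.Theory Num.Theory.
Import numFieldNormedType.Exports.
Local Open Scope classical_set_scope.
Local Open Scope ring_scope.

(** The quadratic sums of f = C + g + h differ from those of g by the sums of
    D(x, y) = (f y - f x)^2 - (g y - g x)^2 = (h y - h x)(2 (g y - g x) + h y - h x)
    over the partition intervals. The claim is that these sums converge, on each
    [s, t], to the excess of the squared jumps of f over those of g. Adding this
    excess to the bracket of g then gives the bracket of f.

    The duality of the variation exponents enters once. If 1/p + 1/q > 1, then
    |x||y| <= e (|x|^q + |y|^p) for all small x and y ([product_le_powers]), and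
    1/p + 1/p > 1 because p < 2; for p = 1 a bound e |y| is immediate. Hence the
    intervals on which f and g both have increments at most d contribute at most
    e to the sum of |D|, for every partition, if d is small
    ([decomposable_negligible]). Everything else uses only this property and the
    existence of one-sided limits.

    For fixed d let [control] s t be the supremum over the partitions of [s, t]
    of the sum of |D| over the small increments; it is superadditive and at most
    e. If f and g oscillate by at most d on the open interval ]u, v[, then up to
    the control only the first and the last partition interval matter, and the
    sums over [u, v] are close to the end jumps ([restr_sum_local]). The same
    end jumps approximate the jump sums ([jump_sum_diff_local]), since a
    superadditive function that dominates single jumps dominates the sum of all
    of them ([esum_le_superadditive]). So the sums of D and the jump sums agree
    locally up to twice the control.

    Regulated functions have small oscillation on short intervals at either side
    of each point, and both sides of the comparison are additive in the interval:
    the jump sums exactly, the sums of D in the limit ([restr_sum_split_cvg]).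
    This is where the location of the jumps is used: at a point u outside all the
    partitions, f and g are both continuous from the right or both from the left,
    so that cutting the interval around u at u does not change the limit of D.
    Interval induction ([interval_induction]) extends the estimate to every
    [s, t], and e is arbitrary ([restr_sum_cvg]). *)

Set Implicit Arguments.
Unset Strict Implicit.

(** * Sums over the intervals of a partition *)

Section ChainSums.
Context {R : realType}.
Implicit Types (F G : R -> R -> R) (c p x y z s t : R) (f : R -> R) (r : seq R).

Fixpoint chain_sum F x r : R :=
  if r is y :: r' then F x y + chain_sum F y r' else 0.

Lemma chain_sum_cat F x r1 r2 :
  chain_sum F x (r1 ++ r2) = chain_sum F x r1 + chain_sum F (last x r1) r2.
Proof. by elim: r1 x => [|y r1 IH] x /=; rewrite ?add0r// IH addrA. Qed.

Lemma chain_sum_rcons F x r y :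
  chain_sum F x (rcons r y) = chain_sum F x r + F (last x r) y.
Proof. by rewrite -cats1 chain_sum_cat /= addr0. Qed.

Lemma chain_sum_ge0 F x r : (forall y z, 0 <= F y z) -> 0 <= chain_sum F x r.
Proof. by move=> F0; elim: r x => [//|y r IH] x /=; rewrite addr_ge0. Qed.

(** Bridge from the indexed sums, whose default value t is never reached, to
    the recursive ones, which are additive under concatenation by computation. *)
Lemma sum_nth_chain F s t r :
  \sum_(0 <= i < size r) F (nth t (s :: r) i) (nth t (s :: r) i.+1)
  = chain_sum F s r.
Proof.
elim: r s => [|x r IH] s /=; first by rewrite big_nil.
by rewrite big_nat_recl// -IH.
Qed.

Lemma quadratic_sumE s t f r :
  quadratic_sum s t f r = chain_sum (fun x y => (f y - f x) ^+ 2) s r.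
Proof. by rewrite /quadratic_sum /= -(sum_nth_chain _ s t). Qed.

Lemma power_sumE p s t f r :
  power_sum p s t f r = chain_sum (fun x y => `|f y - f x| `^ p) s r.
Proof. by rewrite /power_sum /= -(sum_nth_chain _ s t). Qed.

Lemma chain_sumD F G x r :
  chain_sum (fun x y => F x y + G x y) x r = chain_sum F x r + chain_sum G x r.
Proof. by elim: r x => [|y r IH] x /=; [lra|rewrite IH; lra]. Qed.

Lemma chain_sumZ c F x r :
  chain_sum (fun x y => c * F x y) x r = c * chain_sum F x r.
Proof. by elim: r x => [|y r IH] x /=; [lra|rewrite IH; lra]. Qed.

Lemma chain_sumB F G x r :
  chain_sum (fun x y => F x y - G x y) x r = chain_sum F x r - chain_sum G x r.
Proof. by elim: r x => [|y r IH] x /=; [lra|rewrite IH; lra]. Qed.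

Lemma le_chain_sum (P : {pred R}) F G x r :
  (forall y z, P y -> P z -> F y z <= G y z) ->
  P x -> all P r -> chain_sum F x r <= chain_sum G x r.
Proof.
move=> FG; elim: r x => [//|y r IH] x Px /= /andP[Py Pr].
by rewrite lerD ?FG ?IH.
Qed.

Lemma ler_norm_chain_sum F x r :
  `|chain_sum F x r| <= chain_sum (fun y z => `|F y z|) x r.
Proof.
elim: r x => [|y r IH] x /=; first by rewrite normr0.
by rewrite (le_trans (ler_normD _ _))// lerD.
Qed.

Lemma itv_partition_bound s t r : itv_partition s t r ->
  all (fun x => s <= x <= t) r.
Proof.
elim: r s => [//|x r IH] s sr /=.
have xr := itv_partition_cons sr; have [/= /andP[sx _] _] := sr.
rewrite (ltW sx) (itv_partition_le xr) /=.
by apply: sub_all (IH _ xr) => y /andP[xy ->]; rewrite (le_trans (ltW sx)).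
Qed.

Lemma itv_partition_extend a b s t r : a <= s -> t <= b -> itv_partition s t r ->
  exists r1 r2, [/\ itv_partition a s r1, itv_partition t b r2
    & itv_partition a b (r1 ++ r ++ r2)].
Proof.
have H (x y : R) : x <= y -> exists r, itv_partition x y r.
  rewrite le_eqVlt => /predU1P[->|xy]; first by exists [::]; split => /=.
  by exists [:: y]; exact: itv_partition1.
move=> /H[r1 ar1] /H[r2 br2] str; exists r1, r2; split=> //.
exact: itv_partition_cat ar1 (itv_partition_cat str br2).
Qed.

(** For nonnegative terms, a bound over the partitions of the whole interval
    passes to subintervals, since extending a partition only adds terms. *)
Lemma chain_sum_extend a b s t r F M : (forall x y, 0 <= F x y) ->
  (forall r, itv_partition a b r -> chain_sum F a r <= M) ->
  a <= s -> t <= b -> itv_partition s t r -> chain_sum F s r <= M.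
Proof.
move=> F0 FM as_ tb str.
have [r1 [r2 [[_ /eqP l1] p2 /FM]]] := itv_partition_extend as_ tb str.
have [_ /eqP lr] := str.
rewrite !chain_sum_cat l1; apply: le_trans.
by rewrite addrA -addrA addrCA lerDl addr_ge0// chain_sum_ge0.
Qed.

End ChainSums.

(** * Induction on intervals *)

Section IntervalInduction.
Context {R : realType}.

(** The supremum of the points t up to which P s t holds is reached because P
    holds to the left of it, and is the right end because P holds to its right. *)
Lemma interval_induction (a b : R) (P : R -> R -> Prop) :
  (forall s u t, a <= s -> s < u -> u < t -> t <= b ->
     P s u -> P u t -> P s t) ->
  (forall x, a <= x < b -> \forall v \near x^'+, P x v) ->
  (forall x, a < x <= b -> \forall u \near x^'-, P u x) ->
  forall s t, a <= s -> s < t -> t <= b -> P s t.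
Proof.
move=> PD Pr Pl s t as_ st tb.
pose A := [set v | s < v <= t /\ P s v].
have [v0 [sv0 v0t Pv0]] : exists v, [/\ s < v, v < t & P s v].
  have sab : a <= s < b by rewrite as_ (lt_le_trans st tb).
  near s^'+ => v; exists v; split; near: v.
  - exact: nbhs_right_gt.
  - exact: nbhs_right_lt.
  - exact: Pr.
have A0 : A v0 by split=> //; rewrite sv0 ltW.
have hA : has_sup A.
  by split; [exists v0|exists t => v [/andP[]]].
set T := sup A.
have vT : v0 <= T by apply: ub_le_sup => //; case: hA.
have Tt : T <= t by apply: ge_sup; [exists v0|move=> v [/andP[]]].
have sT : s < T := lt_le_trans sv0 vT.
(* a point of A close enough to T is joined to T by the left hypothesis *)
have PT : P s T.
  have aTb : a < T <= b by rewrite (le_lt_trans as_ sT) (le_trans Tt tb).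
  have [e /= e0 he] := Pl _ aTb.
  have [v [svt Psv] Tev] := sup_adherent e0 hA.
  have vleT : v <= T by apply: ub_le_sup; [case: hA|split].
  move: vleT; rewrite le_eqVlt => /predU1P[<-//|vltT].
  have /andP[sv vt] := svt.
  apply: (PD _ v) => //; first by rewrite (le_trans Tt).
  by apply: he => //=; rewrite ger0_norm; [rewrite -/T in Tev; lra|lra].
move: Tt; rewrite le_eqVlt => /predU1P[<-//|Tltt].
(* otherwise the right hypothesis at T carries P beyond the supremum *)
exfalso.
have aTb : a <= T < b by rewrite (le_trans as_ (ltW sT)) (lt_le_trans Tltt tb).
have [v [Tv vt PTv]] : exists v, [/\ T < v, v < t & P T v].
  near T^'+ => v; exists v; split; near: v.
  - exact: nbhs_right_gt.
  - exact: nbhs_right_lt.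
  - exact: Pr.
suff : v <= T by rewrite leNgt Tv.
apply: ub_le_sup; first by case: hA.
split; first by rewrite (lt_trans sT Tv) ltW.
by apply: (PD _ T) => //; rewrite (le_trans (ltW vt)).
Unshelve. all: by end_near. Qed.

End IntervalInduction.

(** * Jump sums below superadditive interval functions *)

Section Superadditive.
Context {R : realType}.
Variables (w : R -> R -> R) (kl kr : R -> R).

Lemma sum_le_superadditive (s t : R) (l : seq R) :
  (forall x y, s <= x -> x < y -> y <= t -> 0 <= w x y) ->
  (forall x y z, s <= x -> x < y -> y < z -> z <= t -> w x y + w y z <= w x z) ->
  (forall x y, s <= x -> x < y -> y < t -> kl y <= w x y) ->
  (forall x y, s < x -> x < y -> y <= t -> kr x <= w x y) ->
  path <%R s (rcons l t) -> \sum_(x <- l) (kl x + kr x) <= w s t.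
Proof.
elim: l s => [|x l IH] s w0 wD wl wr /=.
  by rewrite andbT big_nil => st; rewrite w0.
move=> /andP[sx xlt].
(* z separates x from the remaining points, and from t if there are none *)
have [z [xz zt pz]] : exists z, [/\ x < z, z < t & path <%R z (rcons l t)].
  case: l xlt {IH} => [|y l] /= /andP[xy yl].
    by exists ((x + t) / 2); rewrite andbT; split; lra.
  have yt : y < t.
    by move: (order_path_min lt_trans yl); rewrite all_rcons => /andP[].
  by exists ((x + y) / 2); rewrite yl andbT; split; lra.
rewrite big_cons.
have IHz : \sum_(x <- l) (kl x + kr x) <= w z t.
  apply: IH => //.
  - by move=> u v zu uv vt; apply: w0 => //; lra.
  - by move=> u v r zu uv vr rt; apply: wD => //; lra.
  - by move=> u v zu uv vt; apply: wl => //; lra.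
  - by move=> u v zu uv vt; apply: wr => //; lra.
have h1 : kl x <= w s x by apply: wl; lra.
have h2 : kr x <= w x z by apply: wr; lra.
have h3 : w s x + w x t <= w s t by apply: wD; lra.
have h4 : w x z + w z t <= w x t by apply: wD; lra.
by lra.
Qed.

(** A superadditive interval function that dominates the two jumps at each
    point dominates their sum: separate the points of a finite set by
    intervals lying on either side of them. *)
Lemma esum_le_superadditive (s t : R) : s < t ->
  (forall x y, s <= x -> x < y -> y <= t -> 0 <= w x y) ->
  (forall x y z, s <= x -> x < y -> y < z -> z <= t -> w x y + w y z <= w x z) ->
  (forall x y, s <= x -> x < y -> y < t -> kl y <= w x y) ->
  (forall x y, s < x -> x < y -> y <= t -> kr x <= w x y) ->
  (\esum_(x in `]s, t[) (kl x + kr x)%:E <= (w s t)%:E)%E.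
Proof.
move=> st w0 wD wl wr; apply: ge_ereal_sup => _ [A [finA Ast] <-].
have [l0 Al0] := (finite_seqP A).1 finA.
pose l := sort <=%R (undup l0).
have lA x : (x \in l) = (x \in A).
  by rewrite mem_sort mem_undup Al0; apply/idP/idP; rewrite inE.
have ul : uniq l by rewrite sort_uniq undup_uniq.
have -> : A = [set` l].
  by apply/seteqP; split=> x /=; rewrite lA inE.
rewrite -fsbig_seq// sumEFin lee_fin; apply: sum_le_superadditive => //.
rewrite -cats1 cat_path /= andbT.
have sl x : x \in l -> s < x < t.
  by rewrite lA inE => /Ast; rewrite /= in_itv.
have ltl : sorted <%R l.
  by rewrite lt_sorted_uniq_le ul; exact: sort_le_sorted.
apply/andP; split.
  rewrite path_sortedE ?ltl ?andbT; last exact: lt_trans.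
  by apply/allP => x /sl/andP[].
case/lastP: (l) sl => [//|l' x] /(_ x).
by rewrite mem_rcons mem_head last_rcons => /(_ isT)/andP[].
Qed.

End Superadditive.

(** * Partitions restricted to a subinterval *)

Section RestrictedPartitions.
Context {R : realType}.
Implicit Types (r : seq R) (s t u x y z : R).

Definition inner r s t : seq R := [seq x <- r | s < x < t].

Lemma mem_inner r s t x : (x \in inner r s t) = (s < x < t) && (x \in r).
Proof. by rewrite mem_filter. Qed.

Lemma sorted_inner r s t : sorted <%R r -> sorted <%R (inner r s t).
Proof. by apply: sorted_filter; exact: lt_trans. Qed.

Lemma inner_split r s u t : sorted <%R r -> s < u -> u < t ->
  inner r s t = inner r s u ++ (if u \in r then [:: u] else [::]) ++ inner r u t.
Proof.
move=> sr su ut; apply: lt_sorted_eq.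
- exact: sorted_inner.
- rewrite lt_sorted_pairwise !pairwise_cat -!lt_sorted_pairwise !sorted_inner//=.
  rewrite !andbT; apply/and3P; split.
  + apply/allrelP => x y; rewrite mem_cat !mem_inner => /andP[/andP[_ xu] _].
    case/orP=> [|/andP[/andP[uy _] _]]; last exact: lt_trans uy.
    by case: ifP => //= _; rewrite inE => /eqP ->.
  + apply/allrelP => x y; case: ifP => //= _; rewrite inE => /eqP ->.
    by rewrite mem_inner => /andP[/andP[]].
  + by case: ifP.
- move=> x; rewrite !mem_cat !mem_inner.
  have -> : (x \in (if u \in r then [:: u] else [::])) = (x == u) && (x \in r).
    case: ifPn => ur; first by rewrite inE; case: eqP => // ->; rewrite ur.
    by rewrite in_nil; case: eqP => // ->; rewrite (negbTE ur).
  case: (x \in r); rewrite ?andbF// !andbT.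
  case: (ltgtP x u) => [xu|xu|->] /=; rewrite ?orbF ?andbT ?andbF//.
  + by rewrite (lt_trans xu ut) andbT.
  + by rewrite (lt_trans su xu).
  + by rewrite su ut.
Qed.

Lemma restr_partitionP r s t : sorted <%R r -> s < t ->
  itv_partition s t (restr_partition r s t).
Proof.
move=> sr st; split; last by rewrite last_rcons.
have mi := mem_inner r s t; have si := sorted_inner s t sr.
rewrite /restr_partition -/(inner r s t) -cats1 cat_path /= andbT.
apply/andP; split.
  rewrite path_sortedE ?si ?andbT; last exact: lt_trans.
  by apply/allP => x; rewrite mi => /andP[/andP[]].
have := mem_last s (inner r s t); rewrite inE mi => /predU1P[->//|].
by case/andP => /andP[].
Qed.

Lemma last_inner r s t z : sorted <%R r -> s < t -> s < z < t -> z \in r ->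
  z <= last s (inner r s t) < t.
Proof.
move=> sr st szt zr.
have := restr_partitionP sr st.
rewrite /restr_partition -/(inner r s t) -cats1 => -[].
rewrite cat_path /= andbT => /andP[si ->] _; rewrite andbT.
have : z \in inner r s t by rewrite mem_inner szt.
move: (inner r s t) si => A; clear st szt; elim: A s => [//|x l IH] s /= /andP[_ xl].
rewrite inE => /predU1P[->|]; last exact: IH.
have := mem_last x l; rewrite inE => /predU1P[->//|].
by move: (order_path_min lt_trans xl) => /allP h /h /ltW.
Qed.

Lemma head_inner r s t z : sorted <%R r -> s < z < t -> z \in r ->
  s < head t (inner r s t) <= z.
Proof.
move=> sr szt zr.
have : z \in inner r s t by rewrite mem_inner szt.
have si := sorted_inner s t sr; have mi := mem_inner r s t.
case: (inner r s t) si mi => [//|x l] /= xl mi.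
have := mi x; rewrite mem_head => /esym/andP[/andP[-> _] _] /=.
rewrite inE => /predU1P[->//|].
by move: (order_path_min lt_trans xl) => /allP h /h /ltW.
Qed.

End RestrictedPartitions.

Section Mesh.
Context {R : realType} (a b : R) (lambda : nat -> seq R).
Hypothesis lamL : Lambda a b lambda.
Implicit Types (s t u x y z : R).

Lemma Lambda_sorted m : sorted <%R (lambda m).
Proof. by have [/(_ m)[/path_sorted]] := lamL. Qed.

Lemma Lambda_near_mem u : a < u -> points lambda a u ->
  \forall m \near \oo, u \in lambda m.
Proof.
move=> au [m0 um0]; exists m0 => //= m /subnKC <-.
have [_ lamS _] := lamL.
suff : u \in a :: lambda (m0 + (m - m0)) by rewrite inE gt_eqF.
by elim: (m - m0)%N => [|k IH]; [rewrite addn0|rewrite addnS lamS].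
Qed.

Lemma Lambda_near_between s t : a <= s -> s < t -> t <= b ->
  \forall m \near \oo, exists2 z, z \in lambda m & s < z < t.
Proof.
move=> as_ st tb; have [_ _ cl] := lamL.
have cab : (s + t) / 2 \in `[a, b] by rewrite in_itv /=; apply/andP; split; lra.
have [] := cl _ cab `]s, t[%classic.
  by apply: near_in_itv; rewrite in_itv /=; apply/andP; split; lra.
move=> z [zp]; rewrite /= in_itv /= => szt.
have az : a < z by apply: le_lt_trans as_ _; case/andP: szt.
by apply: filterS (Lambda_near_mem az zp) => m zm; exists z.
Qed.

(** By density the partition point next to an end of the interval tends to that
    end, so that one-sided limits describe the extreme increments. *)
Lemma last_inner_cvg s u : a <= s -> s < u -> u <= b ->
  last s (inner (lambda m) s u) @[m --> \oo] --> u^'-.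
Proof.
move=> as_ su ub Q [e /= e0 eQ].
have sm : s <= Num.max s (u - e) by rewrite le_max lexx.
have mu : Num.max s (u - e) < u by rewrite gt_max su /=; lra.
apply: filterS (Lambda_near_between (le_trans as_ sm) mu ub) => m [z zm].
move=> /andP[+ zu]; rewrite gt_max => /andP[sz uez].
have szu : s < z < u by rewrite sz zu.
have /andP[zl lu] := last_inner (Lambda_sorted m) su szu zm.
by apply: eQ => //=; rewrite ger0_norm; lra.
Qed.

Lemma head_inner_cvg s u : a <= s -> s < u -> u <= b ->
  head u (inner (lambda m) s u) @[m --> \oo] --> s^'+.
Proof.
move=> as_ su ub Q [e /= e0 eQ].
have su' : s < Num.min u (s + e) by rewrite lt_min su /=; lra.
have ub' : Num.min u (s + e) <= b by rewrite ge_min ub.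
apply: filterS (Lambda_near_between as_ su' ub') => m [z zm /andP[sz]].
rewrite lt_min => /andP[zu zse].
have szu : s < z < u by rewrite sz zu.
have /andP[lu zl] := head_inner (Lambda_sorted m) szu zm.
by apply: eQ => //=; rewrite ler0_norm; lra.
Qed.

Lemma inner_near_neq0 s u : a <= s -> s < u -> u <= b ->
  \forall m \near \oo, inner (lambda m) s u <> [::].
Proof.
move=> as_ su ub; apply: filterS (Lambda_near_between as_ su ub) => m [z zm szu].
by have := mem_inner (lambda m) s u z; rewrite szu zm => /[swap] ->.
Qed.

Variable D : R -> R -> R.

Definition restr_sum m s t := chain_sum D s (restr_partition (lambda m) s t).

(** Cutting at u changes the sums only by splitting the one interval around u,
    and only when u is not a partition point. *)
Lemma restr_sum_split s u t : a <= s -> s < u -> u < t -> t <= b ->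
  (points lambda a u \/ forall x y : nat -> R,
     x @ \oo --> u^'- -> y @ \oo --> u^'+ ->
     D (x m) (y m) - D (x m) u - D u (y m) @[m --> \oo] --> 0) ->
  restr_sum m s t - restr_sum m s u - restr_sum m u t @[m --> \oo] --> 0.
Proof.
move=> as_ su ut tb; rewrite /restr_sum /restr_partition.
have [up _|up [//|Du]] := pselect (points lambda a u).
  apply: cvg_near_cst; near=> m; apply/eqP.
  have um : u \in lambda m.
    by near: m; apply: Lambda_near_mem up; apply: le_lt_trans su.
  rewrite -!/(inner _ _ _) (inner_split (Lambda_sorted m) su ut) um /=.
  rewrite -cats1 -catA /= -cat_rcons cats1 chain_sum_cat last_rcons; lra.
have au : a <= u by rewrite (le_trans as_ (ltW su)).
have ub : u <= b by rewrite (le_trans (ltW ut) tb).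
have := Du _ _ (last_inner_cvg as_ su ub) (head_inner_cvg au ut tb).
apply: cvg_trans; apply: near_eq_cvg; near=> m.
have um : u \notin lambda m.
  by apply/negP => um; apply: up; exists m; rewrite inE um orbT.
have : inner (lambda m) u t <> [::] by near: m; exact: inner_near_neq0.
rewrite -!/(inner _ _ _) (inner_split (Lambda_sorted m) su ut) (negbTE um) /=.
case: (inner (lambda m) u t) => [//|y l] _ /=.
by rewrite -cats1 -catA chain_sum_cat chain_sum_rcons /= cats1; lra.
Unshelve. all: by end_near. Qed.

End Mesh.

(** * Sums of squared jumps *)

Lemma cvg_sqr {R : realType} {T : Type} (F : set_system T) (FF : Filter F)
    (u : T -> R) (l : R) : u @ F --> l -> u x ^+ 2 @[x --> F] --> l ^+ 2.
Proof. by move=> ul; exact: (cvgM ul ul). Qed.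

Section JumpSums.
Context {R : realType}.
Implicit Types (f g : R -> R) (s t u x y z : R) (k : R -> R).

Definition jump_sqr f x : R := jumpl f x ^+ 2 + jumpr f x ^+ 2.

Definition inner_sum k s t : \bar R := (\esum_(x in `]s, t[) (k x)%:E)%E.

(** The squared jumps that [s, t] sees from inside. Keeping the two end jumps
    apart makes the sum additive in the interval and isolates the open interval,
    where oscillations can be made small. *)
Definition jump_sum f s t : \bar R :=
  ((jumpr f s ^+ 2)%:E + (jumpl f t ^+ 2)%:E + inner_sum (jump_sqr f) s t)%E.

Lemma jump_sqr_ge0 f x : 0 <= jump_sqr f x.
Proof. by rewrite addr_ge0 ?sqr_ge0. Qed.

Lemma inner_sum_ge0 k s t : (forall x, 0 <= k x) -> (0 <= inner_sum k s t)%E.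
Proof. by move=> k0; apply: esum_ge0 => x _; rewrite lee_fin. Qed.

Lemma esum_disjoint (A B : set R) k : (forall x, 0 <= k x) ->
  (forall x, A x -> ~ B x) ->
  (\esum_(x in A `|` B) (k x)%:E =
   \esum_(x in A) (k x)%:E + \esum_(x in B) (k x)%:E)%E.
Proof.
move=> k0 AB; rewrite (esumID A); last by move=> x _; rewrite lee_fin.
congr (_ + _)%E; congr (esum _ _); apply/seteqP; split=> x /=.
- by case.
- by move=> Ax; split=> //; left.
- by case=> -[].
- by move=> Bx; split; [right|move=> Ax; exact: AB Ax Bx].
Qed.

Lemma inner_sum_split k s u t : (forall x, 0 <= k x) -> s < u -> u < t ->
  (inner_sum k s t = inner_sum k s u + (k u)%:E + inner_sum k u t)%E.
Proof.
move=> k0 su ut; rewrite /inner_sum -(@esum_set1 R R u (fun x => (k x)%:E)).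
  rewrite -!esum_disjoint//.
  - congr (esum _ _); apply/seteqP; split=> x /=; rewrite !in_itv /=.
    + case: (ltgtP x u) => [xu|ux|->].
      * by move=> /andP[-> _]; left; left.
      * by move=> /andP[_ ->]; right.
      * by left; right.
    + by move=> [[/andP[sx xu]|->]|/andP[ux xt]]; apply/andP; split; lra.
  - by move=> x /= [|->]; rewrite !in_itv /= ?ltxx// => /andP[_ xu] /andP[ux _]; lra.
  - by move=> x /=; rewrite in_itv /= => /andP[_ +] xu; rewrite xu ltxx.
by rewrite lee_fin.
Qed.

Lemma jump_sumD f s u t : s < u -> u < t ->
  (jump_sum f s t = jump_sum f s u + jump_sum f u t)%E.
Proof.
move=> su ut; rewrite /jump_sum (inner_sum_split (jump_sqr_ge0 f) su ut).
rewrite /jump_sqr EFinD; set A := inner_sum _ _ _; set B := inner_sum _ _ _.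
by case: A B => [x||] [y||] //=; rewrite -!EFinD; congr EFin; lra.
Qed.

Lemma jump_sum_ge0 f s t : (0 <= jump_sum f s t)%E.
Proof.
apply: adde_ge0; last by apply: inner_sum_ge0; exact: jump_sqr_ge0.
by rewrite -EFinD lee_fin addr_ge0 ?sqr_ge0.
Qed.

Lemma jump_sum_lty f s t :
  (inner_sum (jump_sqr f) s t < +oo)%E = (jump_sum f s t < +oo)%E.
Proof.
by rewrite /jump_sum -EFinD; case: (inner_sum _ _ _) => [r||] /=; rewrite -?EFinD ?ltry ?ltNyr.
Qed.

Lemma jump_sum_fin f s t : (jump_sum f s t < +oo)%E -> jump_sum f s t \is a fin_num.
Proof. by move=> h; rewrite ge0_fin_numE ?jump_sum_ge0. Qed.

Lemma sum_jumps_nil f a : (sum_jumpl_sqr f a a + sum_jumpr_sqr f a a = 0)%E.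
Proof.
by rewrite /sum_jumpl_sqr /sum_jumpr_sqr !set_itvxx !esum_set0 adde0.
Qed.

Lemma sum_jumpsE f a x : a < x ->
  (sum_jumpl_sqr f a x + sum_jumpr_sqr f a x = jump_sum f a x)%E.
Proof.
move=> ax; have sq0 (k : R -> R) y : 0 <= k y ^+ 2 by exact: sqr_ge0.
have -> : sum_jumpl_sqr f a x =
    (inner_sum (fun y => (jumpl f y ^+ 2)%R) a x + (jumpl f x ^+ 2)%:E)%E.
  rewrite /sum_jumpl_sqr /inner_sum.
  rewrite -(@esum_set1 R R x (fun y => (jumpl f y ^+ 2)%:E)) ?lee_fin//.
  rewrite -esum_disjoint//; last first.
    by move=> y /=; rewrite in_itv /= => /andP[_ +] xu; rewrite xu ltxx.
  congr (esum _ _); apply/seteqP; split=> y /=; rewrite !in_itv /=.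
    by case: (ltgtP y x) => [_ /andP[ay _]|_|-> _]; rewrite ?andbF//;
      [left; rewrite ay|right].
  by move=> [/andP[-> /ltW]|->]//; rewrite ax lexx.
have -> : sum_jumpr_sqr f a x =
    ((jumpr f a ^+ 2)%:E + inner_sum (fun y => (jumpr f y ^+ 2)%R) a x)%E.
  rewrite /sum_jumpr_sqr /inner_sum.
  rewrite -(@esum_set1 R R a (fun y => (jumpr f y ^+ 2)%:E)) ?lee_fin//.
  rewrite -esum_disjoint//; last first.
    by move=> y /= ->; rewrite in_itv /= ltxx.
  congr (esum _ _); apply/seteqP; split=> y /=; rewrite !in_itv /=.
    by case: (ltgtP a y) => [_ /andP[_ yx]|//|-> _]; [right|left].
  by move=> [->|/andP[/ltW ->]]//; rewrite ax lexx.
rewrite /jump_sum /inner_sum /jump_sqr.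
under [in RHS]eq_esum do rewrite EFinD.
rewrite esumD//; try by move=> *; rewrite lee_fin.
set A := esum _ _; set B := esum _ _.
by rewrite addeCA -!addeA; congr (_ + _)%E; rewrite addeCA.
Qed.

Lemma regulated_left a b f t : regulated a b f -> a < t <= b ->
  f u @[u --> t^'-] --> llim f t.
Proof. by move=> [fl _] /fl. Qed.

Lemma regulated_right a b f t : regulated a b f -> a <= t < b ->
  f u @[u --> t^'+] --> rlim f t.
Proof. by move=> [_ fr] /fr. Qed.

End JumpSums.

Section BracketJumps.
Context {R : realType}.

Lemma bracket_mono (a b : R) lambda f V s t : is_bracket a b lambda f V ->
  a <= s -> s < t -> t <= b -> V s <= V t.
Proof.
move=> [_ _ VE _ _] as_ st tb; rewrite -subr_ge0.
have h := VE _ _ as_ st tb; rewrite -(cvg_lim _ h)//.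
apply: limr_ge; first by apply/cvg_ex; eexists; exact: h.
apply: nearW => m; rewrite quadratic_sumE chain_sum_ge0// => y z.
exact: sqr_ge0.
Qed.

(** The bracket is nondecreasing and its jumps are the squared jumps of f, so
    its increments dominate the jump sums. *)
Lemma bracket_jump_sum (a b : R) lambda f V s t : is_bracket a b lambda f V ->
  a <= s -> s < t -> t <= b -> (jump_sum f s t < +oo)%E.
Proof.
move=> fV as_ st tb; rewrite -jump_sum_lty.
have [regV _ _ Vl Vr] := fV; have mV := bracket_mono fV.
apply: (@le_lt_trans _ _ (V t - V s)%:E); last exact: ltry.
apply: (@esum_le_superadditive R (fun x y => V y - V x)) => //.
- by move=> x y sx xy yt; rewrite subr_ge0 mV//; lra.
- by move=> x y z *; lra.
- move=> x y sx xy yt.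
  have yab : a < y <= b by apply/andP; split; lra.
  rewrite -Vl// /jumpl lerD2l lerN2.
  have h := regulated_left regV yab; rewrite /llim.
  apply: limr_ge; first by apply/cvg_ex; eexists; exact: h.
  near=> z; apply: mV; first lra.
    by near: z; exact: nbhs_left_gt.
  have : z < y by near: z; exact: nbhs_left_lt.
  by lra.
- move=> x y sx xy yt.
  have xab : a <= x < b by apply/andP; split; lra.
  rewrite -Vr// /jumpr lerD2r.
  have h := regulated_right regV xab; rewrite /rlim.
  apply: limr_le; first by apply/cvg_ex; eexists; exact: h.
  near=> z; apply: mV; last lra.
    have : x < z by near: z; exact: nbhs_right_gt.
    by lra.
  by near: z; exact: nbhs_right_lt.
Unshelve. all: by end_near. Qed.

End BracketJumps.

(** * Differences of squared increments and their control *)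

Section SquareDifference.
Context {R : realType} (f g : R -> R).
Implicit Types (d s t u v x y z : R).

Definition sqr_diff x y : R := (f y - f x) ^+ 2 - (g y - g x) ^+ 2.

Definition jumpl_diff x : R := jumpl f x ^+ 2 - jumpl g x ^+ 2.
Definition jumpr_diff x : R := jumpr f x ^+ 2 - jumpr g x ^+ 2.

Definition small_incr d x y : bool := (`|f y - f x| <= d) && (`|g y - g x| <= d).

Definition small_diff d x y : R :=
  if small_incr d x y then `|sqr_diff x y| else 0.

Lemma small_diff_ge0 d x y : 0 <= small_diff d x y.
Proof. by rewrite /small_diff; case: ifP. Qed.

(** The small increments of f and g contribute arbitrarily little to the
    difference of their quadratic sums, uniformly in the partition. It is through
    this property alone that the variation exponents enter. *)
Definition negligible_small_diff a b : Prop := forall e, 0 < e ->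
  exists2 d, 0 < d & forall s t r, a <= s -> t <= b -> itv_partition s t r ->
    chain_sum (small_diff d) s r <= e.

Lemma sqr_diff_left a b x : regulated a b f -> regulated a b g ->
  a < x <= b -> sqr_diff z x @[z --> x^'-] --> jumpl_diff x.
Proof.
move=> regf regg axb; apply: cvgB; apply: cvg_sqr; apply: cvgB;
  [exact: cvg_cst|exact: (regulated_left regf axb)
  |exact: cvg_cst|exact: (regulated_left regg axb)].
Qed.

Lemma sqr_diff_right a b x : regulated a b f -> regulated a b g ->
  a <= x < b -> sqr_diff x z @[z --> x^'+] --> jumpr_diff x.
Proof.
move=> regf regg axb; apply: cvgB; apply: cvg_sqr; apply: cvgB;
  [exact: (regulated_right regf axb)|exact: cvg_cst
  |exact: (regulated_right regg axb)|exact: cvg_cst].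
Qed.

End SquareDifference.

Section SmallIncrementControl.
Context {R : realType} (f g : R -> R) (a b d e : R).
Hypotheses (regf : regulated a b f) (regg : regulated a b g).
Hypothesis small_le : forall s t r, a <= s -> t <= b -> itv_partition s t r ->
  chain_sum (small_diff f g d) s r <= e.
Implicit Types (s t u v x y z : R).

(** A supremum over partitions, which makes it superadditive: bounds obtained on
    short intervals add up to a bound by the total, hence by e. *)
Definition control s t : R :=
  sup [set chain_sum (small_diff f g d) s r | r in itv_partition s t].

Lemma control_has_sup s t : a <= s -> s < t -> t <= b ->
  has_sup [set chain_sum (small_diff f g d) s r | r in itv_partition s t].
Proof.
move=> as_ st tb; split.
  by eexists; exists [:: t] => //; exact: itv_partition1.
by exists e => _ [r rst <-]; exact: small_le as_ tb rst.
Qed.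

Lemma le_control s t r : a <= s -> s < t -> t <= b -> itv_partition s t r ->
  chain_sum (small_diff f g d) s r <= control s t.
Proof.
move=> as_ st tb rst; apply: ub_le_sup; last by exists r.
by case: (control_has_sup as_ st tb).
Qed.

Lemma control_le s t : a <= s -> s < t -> t <= b -> control s t <= e.
Proof.
move=> as_ st tb; apply: ge_sup; first by case: (control_has_sup as_ st tb).
by move=> _ [r rst <-]; exact: small_le as_ tb rst.
Qed.

Lemma control_ge0 s t : a <= s -> s < t -> t <= b -> 0 <= control s t.
Proof.
move=> as_ st tb; apply: le_trans (le_control as_ st tb (itv_partition1 st)).
by apply: chain_sum_ge0; exact: small_diff_ge0.
Qed.

Lemma control_superadditive s u t : a <= s -> s < u -> u < t -> t <= b ->
  control s u + control u t <= control s t.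
Proof.
move=> as_ su ut tb.
have au : a <= u by lra. have ub : u <= b by lra. have st : s < t by lra.
rewrite -lerBrDr; apply: ge_sup; first by case: (control_has_sup as_ su ub).
move=> _ [r1 r1P <-]; rewrite lerBrDr -lerBrDl.
apply: ge_sup; first by case: (control_has_sup au ut tb).
move=> _ [r2 r2P <-]; rewrite lerBrDl.
apply: le_trans (le_control as_ st tb (itv_partition_cat r1P r2P)).
by rewrite chain_sum_cat; case: r1P => _ /eqP ->.
Qed.

Definition small_osc u v : Prop :=
  forall x y, u < x < v -> u < y < v -> small_incr f g d x y.

Section Local.
Variables (u v : R).
Hypotheses (au : a <= u) (uv : u < v) (vb : v <= b) (osc : small_osc u v).

(** A jump inside an interval of small oscillation is the limit of increments
    that are counted by the control. *)
Lemma jumpl_diff_le_control y x : u <= y -> y < x -> x < v ->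
  `|jumpl_diff f g x| <= control y x.
Proof.
move=> uy yx xv; move: (au) (uv) (vb) => au' uv' vb'.
have axb : a < x <= b by apply/andP; split; lra.
have h1 : `|sqr_diff f g z x| @[z --> x^'-] --> `|jumpl_diff f g x|.
  by apply: cvg_norm; exact: (sqr_diff_left regf regg axb).
rewrite -(cvg_lim _ h1)//; apply: limr_le.
  by apply/cvg_ex; eexists; exact: h1.
near=> z.
have yz : y < z by near: z; exact: nbhs_left_gt.
have zx : z < x by near: z; exact: nbhs_left_lt.
have yzx : itv_partition y x [:: z; x] by split=> //=; rewrite yz zx.
have ay : a <= y by lra. have xb : x <= b by lra.
apply: le_trans (le_control ay yx xb yzx).
rewrite /= addr0 [leRHS]addrC /small_diff osc ?lerDl.
- by case: ifP.
- by apply/andP; split; lra.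
- by apply/andP; split; lra.
Unshelve. all: by end_near. Qed.

Lemma jumpr_diff_le_control x y : u < x -> x < y -> y <= v ->
  `|jumpr_diff f g x| <= control x y.
Proof.
move=> ux xy yv; move: (au) (uv) (vb) => au' uv' vb'.
have axb : a <= x < b by apply/andP; split; lra.
have h1 : `|sqr_diff f g x z| @[z --> x^'+] --> `|jumpr_diff f g x|.
  by apply: cvg_norm; exact: (sqr_diff_right regf regg axb).
rewrite -(cvg_lim _ h1)//; apply: limr_le.
  by apply/cvg_ex; eexists; exact: h1.
near=> z.
have xz : x < z by near: z; exact: nbhs_right_gt.
have zy : z < y by near: z; exact: nbhs_right_lt.
have xzy : itv_partition x y [:: z; y] by split=> //=; rewrite xz zy.
have ax : a <= x by lra. have yb : y <= b by lra.
apply: le_trans (le_control ax xy yb xzy).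
rewrite /= addr0 {1}/small_diff osc ?lerDl ?small_diff_ge0//.
- by apply/andP; split; lra.
- by apply/andP; split; lra.
Unshelve. all: by end_near. Qed.

Lemma inner_jump_diff_le_control :
  (inner_sum (fun x => `|jumpl_diff f g x| + `|jumpr_diff f g x|)%R u v
     <= (control u v)%:E)%E.
Proof.
move: (au) (uv) (vb) => au' uv' vb'.
apply: esum_le_superadditive => //.
- by move=> x y ux xy yv; apply: control_ge0; lra.
- by move=> x y z ux xy yz zv; apply: control_superadditive; lra.
- exact: jumpl_diff_le_control.
- exact: jumpr_diff_le_control.
Qed.

Lemma le_inner_jump_sqr k1 k2 :
  (forall x, k1 x - k2 x <= `|jumpl_diff f g x| + `|jumpr_diff f g x|) ->
  (forall x, 0 <= k1 x) -> (forall x, 0 <= k2 x) ->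
  (inner_sum k1 u v <= inner_sum k2 u v + (control u v)%:E)%E.
Proof.
move=> k12 k10 k20.
apply: le_trans (leeD2l _ inner_jump_diff_le_control).
rewrite /inner_sum -esumD.
- apply: le_esum => x _; rewrite -EFinD lee_fin; have := k12 x; lra.
- by move=> x _; rewrite lee_fin.
- by move=> x _; rewrite lee_fin addr_ge0.
Qed.

Lemma le_inner_jump_sqr_fg :
  (inner_sum (jump_sqr f) u v <= inner_sum (jump_sqr g) u v + (control u v)%:E)%E.
Proof.
apply: le_inner_jump_sqr => [x|x|x]; try exact: jump_sqr_ge0.
rewrite /jump_sqr /jumpl_diff /jumpr_diff.
set A := jumpl f x ^+ 2; set B := jumpl g x ^+ 2.
set A' := jumpr f x ^+ 2; set B' := jumpr g x ^+ 2.
by have := ler_norm (A - B); have := ler_norm (A' - B'); lra.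
Qed.

Lemma le_inner_jump_sqr_gf :
  (inner_sum (jump_sqr g) u v <= inner_sum (jump_sqr f) u v + (control u v)%:E)%E.
Proof.
apply: le_inner_jump_sqr => [x|x|x]; try exact: jump_sqr_ge0.
rewrite /jump_sqr /jumpl_diff /jumpr_diff distrC (distrC (jumpr f x ^+ 2)).
set A := jumpl f x ^+ 2; set B := jumpl g x ^+ 2.
set A' := jumpr f x ^+ 2; set B' := jumpr g x ^+ 2.
by have := ler_norm (B - A); have := ler_norm (B' - A'); lra.
Qed.

Definition jump_sum_diff s t : R := fine (jump_sum f s t) - fine (jump_sum g s t).

(** The jumps inside the interval are small, so the excess of those of f over
    those of g is dominated by the control; the end jumps may be large. *)
Lemma jump_sum_diff_local :
  (jump_sum f u v < +oo)%E -> (jump_sum g u v < +oo)%E ->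
  `|jump_sum_diff u v - jumpr_diff f g u - jumpl_diff f g v| <= control u v.
Proof.
rewrite -!jump_sum_lty => finf fing; rewrite /jump_sum_diff /jump_sum.
have := le_inner_jump_sqr_fg; have := le_inner_jump_sqr_gf.
have := inner_sum_ge0 u v (jump_sqr_ge0 f).
have := inner_sum_ge0 u v (jump_sqr_ge0 g).
move: finf fing; case: (inner_sum (jump_sqr f) u v) => [A||]//.
case: (inner_sum (jump_sqr g) u v) => [B||]// _ _ _ _.
rewrite -!EFinD !lee_fin /= /jumpr_diff /jumpl_diff => h1 h2.
by rewrite ler_norml; apply/andP; split; lra.
Qed.

Section Mesh.
Variable lambda : nat -> seq R.
Hypothesis lamL : Lambda a b lambda.

(** The first and the last increment tend to the end jumps; the others are
    small, so the control bounds their contribution. *)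
Lemma restr_sum_local eta : 0 < eta -> \forall m \near \oo,
  `|restr_sum lambda (sqr_diff f g) m u v - jumpr_diff f g u - jumpl_diff f g v|
     <= control u v + eta.
Proof.
move=> eta0; move: (au) (uv) (vb) => au' uv' vb'.
have uab : a <= u < b by apply/andP; split; lra.
have vab : a < v <= b by apply/andP; split; lra.
have hr : sqr_diff f g u (head v (inner (lambda m) u v)) @[m --> \oo]
    --> jumpr_diff f g u.
  exact: cvg_comp (head_inner_cvg lamL au uv vb) (sqr_diff_right regf regg uab).
have hl : sqr_diff f g (last u (inner (lambda m) u v)) v @[m --> \oo]
    --> jumpl_diff f g v.
  exact: cvg_comp (last_inner_cvg lamL au uv vb) (sqr_diff_left regf regg vab).
have eta2 : 0 < eta / 2 by lra.
move/cvgrPdist_le: hr => /(_ _ eta2) hr; move/cvgrPdist_le: hl => /(_ _ eta2) hl.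
near=> m.
have : `|jumpr_diff f g u - sqr_diff f g u (head v (inner (lambda m) u v))|
  <= eta / 2 by near: m.
have : `|jumpl_diff f g v - sqr_diff f g (last u (inner (lambda m) u v)) v|
  <= eta / 2 by near: m.
have : inner (lambda m) u v <> [::].
  by near: m; exact: (inner_near_neq0 lamL au uv vb).
have inuv x : x \in inner (lambda m) u v -> u < x < v.
  by rewrite mem_inner => /andP[].
have := le_control au uv vb (restr_partitionP (Lambda_sorted lamL m) uv).
rewrite /restr_sum /restr_partition -/(inner (lambda m) u v).
case: (inner (lambda m) u v) inuv => [//|y l] inuv /=.
rewrite !chain_sum_rcons /=.
set c := chain_sum _ y l; set c' := chain_sum _ y l => + _.
have cc' : `|c'| <= c.
  apply: le_trans (ler_norm_chain_sum _ _ _) _.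
  apply: (@le_chain_sum R [pred x | u < x < v]).
  - by move=> x z /= xuv zuv; rewrite /small_diff osc.
  - by rewrite /= inuv// mem_head.
  - by apply/allP => x xl /=; rewrite inuv// inE xl orbT.
have := small_diff_ge0 f g d u y; have := small_diff_ge0 f g d (last y l) v.
move: cc'; rewrite !ler_norml => /andP[? ?] ? ? ? /andP[? ?] /andP[? ?].
by apply/andP; split; lra.
Unshelve. all: by end_near. Qed.

End Mesh.
End Local.
End SmallIncrementControl.

(** * From local estimates to the bracket *)

Section NearIntervals.
Context {R : realType}.
Implicit Types (f g : R -> R) (a b d x : R).

Lemma near_right_itv (P : R -> Prop) x : (\forall y \near x^'+, P y) ->
  \forall v \near x^'+, forall y, x < y < v -> P y.
Proof.
move=> [e /= e0 eP]; exists e => //= v; rewrite /ball_ /= => xve xv y /andP[xy yv].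
apply: eP => //=; move: xve; rewrite !ler0_norm; lra.
Qed.

Lemma near_left_itv (P : R -> Prop) x : (\forall y \near x^'-, P y) ->
  \forall v \near x^'-, forall y, v < y < x -> P y.
Proof.
move=> [e /= e0 eP]; exists e => //= v; rewrite /ball_ /= => xve xv y /andP[xy yv].
apply: eP => //=; move: xve; rewrite !ger0_norm; lra.
Qed.

Lemma small_osc_right f g a b d x : regulated a b f -> regulated a b g ->
  0 < d -> a <= x < b -> \forall v \near x^'+, small_osc f g d x v.
Proof.
move=> regf regg d0 xab; have d2 : 0 < d / 2 by lra.
have /cvgrPdist_le/(_ _ d2) hf := regulated_right regf xab.
have /cvgrPdist_le/(_ _ d2) hg := regulated_right regg xab.
apply: filterS2 (near_right_itv hf) (near_right_itv hg) => v fv gv y z yv zv.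
have := fv _ yv; have := fv _ zv; have := gv _ yv; have := gv _ zv.
rewrite /small_incr !ler_norml => /andP[? ?] /andP[? ?] /andP[? ?] /andP[? ?].
by apply/andP; split; apply/andP; split; lra.
Qed.

Lemma small_osc_left f g a b d x : regulated a b f -> regulated a b g ->
  0 < d -> a < x <= b -> \forall v \near x^'-, small_osc f g d v x.
Proof.
move=> regf regg d0 xab; have d2 : 0 < d / 2 by lra.
have /cvgrPdist_le/(_ _ d2) hf := regulated_left regf xab.
have /cvgrPdist_le/(_ _ d2) hg := regulated_left regg xab.
apply: filterS2 (near_left_itv hf) (near_left_itv hg) => v fv gv y z yv zv.
have := fv _ yv; have := fv _ zv; have := gv _ yv; have := gv _ zv.
rewrite /small_incr !ler_norml => /andP[? ?] /andP[? ?] /andP[? ?] /andP[? ?].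
by apply/andP; split; apply/andP; split; lra.
Qed.

End NearIntervals.

Section Comparison.
Context {R : realType} (f g : R -> R) (a b : R) (lambda : nat -> seq R).
Hypotheses (regf : regulated a b f) (regg : regulated a b g).
Hypothesis negl : negligible_small_diff f g a b.
Hypothesis g_fin : forall s t, a <= s -> s < t -> t <= b ->
  (jump_sum g s t < +oo)%E.
Implicit Types (s t u v x y z : R).

(** Locally the jump sum of f exceeds that of g by at most the control and two
    end jumps; additivity propagates finiteness. *)
Lemma jump_sum_finite s t : a <= s -> s < t -> t <= b ->
  (jump_sum f s t < +oo)%E.
Proof.
have [d d0 small_le] := negl ltr01.
have loc x y : a <= x -> x < y -> y <= b -> small_osc f g d x y ->
    (jump_sum f x y < +oo)%E.
  move=> ax xy yb osc; rewrite -jump_sum_lty.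
  apply: le_lt_trans (le_inner_jump_sqr_fg regf regg small_le ax xy yb osc) _.
  by apply: lte_add_pinfty; rewrite ?ltry// jump_sum_lty g_fin.
move: s t; apply: interval_induction.
- by move=> s u t as_ su ut tb Psu Put; rewrite (jump_sumD _ su ut) lte_add_pinfty.
- move=> x xab; have /andP[ax xb] := xab; near=> v.
  apply: loc => //.
  + by apply: ltW; near: v; exact: nbhs_right_lt.
  + by near: v; exact: (small_osc_right regf regg).
- move=> x xab; have /andP[ax xb] := xab; near=> u.
  apply: loc => //.
  + by apply: ltW; near: u; exact: nbhs_left_gt.
  + by near: u; exact: (small_osc_left regf regg).
Unshelve. all: by end_near. Qed.

Local Notation K := (jump_sum_diff f g).

Lemma jump_sum_diffD s u t : a <= s -> s < u -> u < t -> t <= b ->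
  K s t = K s u + K u t.
Proof.
move=> as_ su ut tb; rewrite /jump_sum_diff !(jump_sumD _ su ut).
have ub : u <= b by lra. have au : a <= u by lra.
have f1 := jump_sum_fin (jump_sum_finite as_ su ub).
have f2 := jump_sum_fin (jump_sum_finite au ut tb).
have g1 := jump_sum_fin (g_fin as_ su ub).
have g2 := jump_sum_fin (g_fin au ut tb).
by rewrite (fineD f1 f2) (fineD g1 g2); lra.
Qed.

(** On a short interval to the right of s only the jump at s survives: the jump
    at the far end is itself bounded by the control. *)
Lemma jump_sum_diff_right s : a <= s < b -> K s v @[v --> s^'+] --> jumpr_diff f g s.
Proof.
move=> sab; have /andP[as_ sb] := sab; apply/cvgrPdist_le => e e0.
have e2 : 0 < e / 2 by lra.
have [d d0 small_le] := negl e2.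
(* v is fixed first, so that t lies inside an interval of small oscillation
   and the jump at t is controlled *)
have [v [sv vb osc]] : exists v, [/\ s < v, v <= b & small_osc f g d s v].
  near s^'+ => v; exists v; split.
  - by near: v; exact: nbhs_right_gt.
  - by apply: ltW; near: v; exact: nbhs_right_lt.
  - by near: v; exact: (small_osc_right regf regg).
near=> t.
have st : s < t by near: t; exact: nbhs_right_gt.
have tv : t < v by near: t; exact: nbhs_right_lt.
have tb : t <= b by lra.
have osct : small_osc f g d s t by move=> x y xst yst; apply: osc; lra.
have := jump_sum_diff_local regf regg small_le as_ st tb osct
  (jump_sum_finite as_ st tb) (g_fin as_ st tb).
have := jumpl_diff_le_control regf regg small_le as_ sv vb osc (lexx s) st tv.
have := control_le small_le as_ st tb.
rewrite !ler_norml => ? /andP[? ?] /andP[? ?]; apply/andP; split; lra.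
Unshelve. all: by end_near. Qed.

Lemma jump_sum_diff_left t : a < t <= b -> K u t @[u --> t^'-] --> jumpl_diff f g t.
Proof.
move=> tab; have /andP[at_ tb] := tab; apply/cvgrPdist_le => e e0.
have e2 : 0 < e / 2 by lra.
have [d d0 small_le] := negl e2.
have [v [vt av osc]] : exists v, [/\ v < t, a <= v & small_osc f g d v t].
  near t^'- => v; exists v; split.
  - by near: v; exact: nbhs_left_lt.
  - by apply: ltW; near: v; exact: nbhs_left_gt.
  - by near: v; exact: (small_osc_left regf regg).
near=> s.
have st : s < t by near: s; exact: nbhs_left_lt.
have vs : v < s by near: s; exact: nbhs_left_gt.
have as_ : a <= s by lra.
have oscs : small_osc f g d s t by move=> x y xst yst; apply: osc; lra.
have := jump_sum_diff_local regf regg small_le as_ st tb oscs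
  (jump_sum_finite as_ st tb) (g_fin as_ st tb).
have := jumpr_diff_le_control regf regg small_le av vt tb osc vs st (lexx t).
have := control_le small_le as_ st tb.
rewrite !ler_norml => ? /andP[? ?] /andP[? ?]; apply/andP; split; lra.
Unshelve. all: by end_near. Qed.

Section Limit.
Hypothesis lamL : Lambda a b lambda.
Hypothesis cut : forall u, a < u < b -> points lambda a u \/
  (jumpr f u = 0 /\ jumpr g u = 0) \/ (jumpl f u = 0 /\ jumpl g u = 0).

Local Notation D := (sqr_diff f g).
Local Notation E := (restr_sum lambda D).

(** If f and g are both right-continuous at u, or both left-continuous there,
    then an interval shrinking to u contributes in the limit the same amount
    whether or not it is cut at u. *)
Lemma sqr_diff_cut u : a < u < b ->
  (jumpr f u = 0 /\ jumpr g u = 0) \/ (jumpl f u = 0 /\ jumpl g u = 0) ->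
  forall x y : nat -> R, x @ \oo --> u^'- -> y @ \oo --> u^'+ ->
  D (x m) (y m) - D (x m) u - D u (y m) @[m --> \oo] --> 0.
Proof.
move=> /andP[au ub] cont x y xu yu.
have uabl : a < u <= b by rewrite au ltW.
have uabr : a <= u < b by rewrite ub ltW.
have hl : D (x m) u @[m --> \oo] --> jumpl_diff f g u.
  exact: cvg_comp xu (sqr_diff_left regf regg uabl).
have hr : D u (y m) @[m --> \oo] --> jumpr_diff f g u.
  exact: cvg_comp yu (sqr_diff_right regf regg uabr).
have h : D (x m) (y m) @[m --> \oo] -->
    (rlim f u - llim f u) ^+ 2 - (rlim g u - llim g u) ^+ 2.
  apply: cvgB; apply: cvg_sqr; apply: cvgB.
  - exact: cvg_comp yu (regulated_right regf uabr).
  - exact: cvg_comp xu (regulated_left regf uabl).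
  - exact: cvg_comp yu (regulated_right regg uabr).
  - exact: cvg_comp xu (regulated_left regg uabl).
suff -> : 0 = (rlim f u - llim f u) ^+ 2 - (rlim g u - llim g u) ^+ 2
    - jumpl_diff f g u - jumpr_diff f g u.
  by apply: cvgB => //; apply: cvgB.
rewrite /jumpl_diff /jumpr_diff /jumpl /jumpr.
case: cont => -[]; rewrite /jumpl /jumpr => /subr0_eq -> /subr0_eq ->; lra.
Qed.

Lemma restr_sum_split_cvg s u t : a <= s -> s < u -> u < t -> t <= b ->
  E m s t - E m s u - E m u t @[m --> \oo] --> 0.
Proof.
move=> as_ su ut tb; apply: (restr_sum_split lamL) => //.
have uab : a < u < b by apply/andP; split; lra.
by have [?|?] := cut uab; [left|right; exact: sqr_diff_cut].
Qed.

(** The two local estimates compare both sides with the same end jumps, whence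
    the factor 2. The bound is superadditive and the sums are asymptotically
    additive, so it extends from short intervals to all of them. *)
Lemma restr_sum_near d e s t : 0 < d ->
  (forall s t r, a <= s -> t <= b -> itv_partition s t r ->
     chain_sum (small_diff f g d) s r <= e) ->
  a <= s -> s < t -> t <= b -> forall eta, 0 < eta ->
  \forall m \near \oo, `|E m s t - K s t| <= 2 * control f g d s t + eta.
Proof.
move=> d0 small_le.
have loc x y : a <= x -> x < y -> y <= b -> small_osc f g d x y ->
    forall eta, 0 < eta ->
    \forall m \near \oo, `|E m x y - K x y| <= 2 * control f g d x y + eta.
  move=> ax xy yb osc eta eta0.
  apply: filterS (restr_sum_local regf regg small_le ax xy yb osc lamL eta0) => m.
  have := jump_sum_diff_local regf regg small_le ax xy yb osc
    (jump_sum_finite ax xy yb) (g_fin ax xy yb).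
  rewrite !ler_norml => /andP[? ?] /andP[? ?]; apply/andP; split; lra.
move: s t; apply: interval_induction.
- move=> s u t as_ su ut tb Psu Put eta eta0.
  have eta3 : 0 < eta / 3 by lra.
  have /cvgrPdist_le/(_ _ eta3) := restr_sum_split_cvg as_ su ut tb.
  apply: filterS3 (Psu _ eta3) (Put _ eta3) => m.
  have := control_superadditive small_le as_ su ut tb.
  rewrite (jump_sum_diffD as_ su ut tb) !ler_norml.
  move=> ? /andP[? ?] /andP[? ?] /andP[? ?]; apply/andP; split; lra.
- move=> x xab; have /andP[ax xb] := xab; near=> v.
  apply: loc => //.
  + by apply: ltW; near: v; exact: nbhs_right_lt.
  + by near: v; exact: (small_osc_right regf regg).
- move=> x xab; have /andP[ax xb] := xab; near=> u.
  apply: loc => //.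
  + by apply: ltW; near: u; exact: nbhs_left_gt.
  + by near: u; exact: (small_osc_left regf regg).
Unshelve. all: by end_near. Qed.

Lemma restr_sum_cvg s t : a <= s -> s < t -> t <= b ->
  E m s t @[m --> \oo] --> K s t.
Proof.
move=> as_ st tb; apply/cvgrPdist_le => e e0.
have e4 : 0 < e / 4 by lra. have e2 : 0 < e / 2 by lra.
have [d d0 small_le] := negl e4.
apply: filterS (restr_sum_near d0 small_le as_ st tb e2) => m.
have := control_le small_le as_ st tb.
rewrite distrC => ? h; apply: le_trans h _; lra.
Qed.

(** The excess of the squared jumps of f over those of g up to x, written with
    the sums that define the continuous part of a bracket. *)
Definition jump_correction x : R :=
  fine (sum_jumpl_sqr f a x + sum_jumpr_sqr f a x)%E
  - fine (sum_jumpl_sqr g a x + sum_jumpr_sqr g a x)%E.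

Lemma jump_correctionB s t : a <= s -> s < t -> t <= b ->
  jump_correction t - jump_correction s = K s t.
Proof.
move=> as_ st tb; have at_ := le_lt_trans as_ st.
rewrite /jump_correction !(sum_jumpsE _ at_).
move: as_; rewrite le_eqVlt => /predU1P[eas|as_].
  by subst s; rewrite !sum_jumps_nil /= /jump_sum_diff; lra.
rewrite !(sum_jumpsE _ as_).
by have := jump_sum_diffD (lexx a) as_ st tb; rewrite {1 2}/jump_sum_diff; lra.
Qed.

(** The quadratic sums of f are those of g plus the sums of the differences of
    squared increments, and each of the two families converges. *)
Lemma is_bracket_comparison V : is_bracket a b lambda g V ->
  is_bracket a b lambda f (V \+ jump_correction).
Proof.
move=> [regV V0 VE Vl Vr].
have cl t : a < t <= b -> (V \+ jump_correction) u @[u --> t^'-] -->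
    llim V t + (jump_correction t - jumpl_diff f g t).
  move=> tab; have /andP[at_ tb] := tab; apply: cvgD.
    exact: (regulated_left regV tab).
  have h : jump_correction t - K u t @[u --> t^'-] -->
      jump_correction t - jumpl_diff f g t.
    by apply: cvgB; [exact: cvg_cst|exact: jump_sum_diff_left].
  apply: cvg_trans h; apply: near_eq_cvg; near=> u.
  have au : a <= u by apply: ltW; near: u; exact: nbhs_left_gt.
  have ut : u < t by near: u; exact: nbhs_left_lt.
  by rewrite /= -(jump_correctionB au ut tb); lra.
have cr s : a <= s < b -> (V \+ jump_correction) u @[u --> s^'+] -->
    rlim V s + (jump_correction s + jumpr_diff f g s).
  move=> sab; have /andP[as_ sb] := sab; apply: cvgD.
    exact: (regulated_right regV sab).
  have h : jump_correction s + K s u @[u --> s^'+] -->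
      jump_correction s + jumpr_diff f g s.
    by apply: cvgD; [exact: cvg_cst|exact: jump_sum_diff_right].
  apply: cvg_trans h; apply: near_eq_cvg; near=> u.
  have su : s < u by near: u; exact: nbhs_right_gt.
  have ub : u <= b by apply: ltW; near: u; exact: nbhs_right_lt.
  by rewrite /= -(jump_correctionB as_ su ub); lra.
split.
- by split=> [t /cl h|s /cr h]; apply/cvg_ex; eexists; exact: h.
- by rewrite /= V0 /jump_correction !sum_jumps_nil /= subrr addr0.
- move=> s t as_ st tb /=.
  have -> : V t + jump_correction t - (V s + jump_correction s)
    = V t - V s + K s t by rewrite -(jump_correctionB as_ st tb); lra.
  have h : quadratic_sum s t g (restr_partition (lambda m) s t) + E m s t
      @[m --> \oo] --> V t - V s + K s t.
    by apply: cvgD; [exact: VE|exact: restr_sum_cvg].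
  apply: cvg_trans h; apply: near_eq_cvg; apply: nearW => m /=.
  by rewrite /restr_sum /sqr_diff chain_sumB -!(quadratic_sumE _ t); lra.
- move=> t tab; rewrite /jumpl /llim (cvg_lim _ (cl _ tab))//= -/(llim f t).
  by have := Vl _ tab; rewrite /jumpl_diff /jumpl; lra.
- move=> s sab; rewrite /jumpr /rlim (cvg_lim _ (cr _ sab))//= -/(rlim f s).
  by have := Vr _ sab; rewrite /jumpr_diff /jumpr; lra.
Unshelve. all: by end_near. Qed.

End Limit.

End Comparison.

(** * Increments of functions of dual variation *)

Section VariationDuality.
Context {R : realType}.
Implicit Types (f g h : R -> R) (a b p q x y : R).

Lemma powR_homo (r x y : R) : 0 <= r -> 0 <= x -> x <= y -> x `^ r <= y `^ r.
Proof.
move=> r0 x0 xy; apply: (ge0_ler_powR r0) => //.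
by rewrite nnegrE (le_trans x0).
Qed.

Lemma powRVK (r x : R) : 0 < r -> 0 <= x -> (x `^ r^-1) `^ r = x.
Proof. by move=> r0 x0; rewrite -powRrM mulVf ?gt_eqF// powRr1. Qed.

Lemma powRKV (r x : R) : 0 < r -> 0 <= x -> (x `^ r) `^ r^-1 = x.
Proof. by move=> r0 x0; rewrite -powRrM mulfV ?gt_eqF// powRr1. Qed.

(** With M the larger of |x|^p and |y|^q, the product |x||y| is at most M to
    the power 1/p + 1/q, which is negligible with respect to M as M tends to 0
    because the exponent exceeds 1. *)
Lemma product_le_powers p q : 0 < p -> 0 < q -> 1 < p^-1 + q^-1 ->
  forall e, 0 < e -> exists2 d, 0 < d &
  forall x y, `|x| <= d -> `|y| <= d -> `|x| * `|y| <= e * (`|x| `^ p + `|y| `^ q).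
Proof.
move=> p0 q0 pq e e0; set k := p^-1 + q^-1 - 1.
have k0 : 0 < k by rewrite /k; lra.
(* m is chosen so that M <= m forces M^k <= e, with k the excess exponent *)
pose m := e `^ k^-1; have m0 : 0 < m by exact: powR_gt0.
have bound (r z : R) : 0 < r -> `|z| <= m `^ r^-1 -> `|z| `^ r <= m.
  move=> r0 zm; rewrite -[leRHS](powRVK r0 (ltW m0)).
  by apply: powR_homo => //; exact: ltW.
exists (Num.min (m `^ p^-1) (m `^ q^-1)); first by rewrite lt_min !powR_gt0.
move=> x y; rewrite !le_min => /andP[/(bound _ _ p0) xm _] /andP[_ /(bound _ _ q0) ym].
set M := Num.max (`|x| `^ p) (`|y| `^ q).
have M0 : 0 <= M by rewrite le_max powR_ge0.
have Mm : M <= m by rewrite ge_max xm ym.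
have root (r z : R) : 0 < r -> `|z| `^ r <= M -> `|z| <= M `^ r^-1.
  move=> r0 zM; rewrite -[leLHS](powRKV r0 (normr_ge0 z)).
  by apply: powR_homo => //; rewrite ?invr_ge0 ?powR_ge0// ltW.
have xM : `|x| <= M `^ p^-1 by apply: root => //; rewrite le_max lexx.
have yM : `|y| <= M `^ q^-1 by apply: root => //; rewrite le_max lexx orbT.
have Mk : M `^ k <= e.
  rewrite -[leRHS](powRVK k0 (ltW e0)).
  by apply: powR_homo => //; exact: ltW.
apply: (@le_trans _ _ (M `^ p^-1 * M `^ q^-1)); first by rewrite ler_pM.
rewrite -powRD; last by rewrite gt_eqF// (lt_trans ltr01).
have -> : p^-1 + q^-1 = 1 + k by rewrite /k; lra.
rewrite powRD; last by rewrite gt_eqF//; lra.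
rewrite powRr1// mulrC; apply: ler_pM => //; first exact: powR_ge0.
by rewrite ge_max lerDl lerDr !powR_ge0.
Qed.

Lemma Wp_chain_sum p a b f : a < b -> Wp p a b f ->
  exists2 M, 0 <= M & forall s t r, a <= s -> t <= b -> itv_partition s t r ->
    chain_sum (fun x y => `|f y - f x| `^ p) s r <= M.
Proof.
move=> ab; rewrite /Wp /= /pvariation; set S := [set _ | _ in _].
have le_sup r : itv_partition a b r ->
    ((chain_sum (fun x y => `|f y - f x| `^ p) a r)%:E <= ereal_sup S)%E.
  by move=> abr; apply: ereal_sup_ubound; exists r => //; rewrite power_sumE.
have F0 x y : 0 <= `|f y - f x| `^ p by exact: powR_ge0.
case: (ereal_sup S) le_sup => [M||]// le_sup _; last first.
  by have := le_sup _ (itv_partition1 ab).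
exists M.
  by have := le_sup _ (itv_partition1 ab); rewrite lee_fin; apply: le_trans;
    exact: chain_sum_ge0.
by move=> s t r; apply: chain_sum_extend => // r' /le_sup.
Qed.

(** The difference of the squared increments of f and g is the increment of h
    times the sum of those of f and g; this is summable against the variations
    of h and g. *)
Lemma decomposable_negligible a b p f g h : a < b -> 1 <= p < 2 ->
  dualW p a b g -> Wp p a b h ->
  (exists C, forall t, a <= t <= b -> f t = C + g t + h t) ->
  negligible_small_diff f g a b.
Proof.
move=> ab /andP[p1 p2] gp hp [C fE] e e0.
have [Mh Mh0 hM] := Wp_chain_sum ab hp.
have incr d x y : a <= x <= b -> a <= y <= b -> small_incr f g d x y ->
    `|h y - h x| <= 2 * d /\ `|sqr_diff f g x y| =
      `|h y - h x| * `|(f y - f x) + (g y - g x)|.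
  move=> /fE fx /fE fy; rewrite /small_incr /sqr_diff fx fy => /andP[fd gd].
  split; last by rewrite -normrM; congr (`|_|); ring.
  by move: fd gd; rewrite !ler_norml => /andP[? ?] /andP[? ?]; apply/andP; split; lra.
have in_ab s t r : a <= s -> t <= b -> itv_partition s t r ->
    (a <= s <= b) /\ all [pred x | a <= x <= b] r.
  move=> as_ tb rst; have st := itv_partition_le rst; split.
    by apply/andP; split; lra.
  by apply: sub_all (itv_partition_bound rst) => x /andP[sx xt] /=;
    apply/andP; split; lra.
case: gp => [[pE _] |[p1' [q [q0 pq gq]]]].
  (* the sum of the increments of f and g is at most 2 d, and h has finite
     1-variation *)
  pose d := e / (2 * (Mh + 1)).
  have d0 : 0 < d by rewrite divr_gt0//; lra.
  exists d => // s t r as_ tb rst; have [sab rab] := in_ab _ _ _ as_ tb rst.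
  apply: (@le_trans _ _
    (chain_sum (fun x y => (2 * d) * (`|h y - h x| `^ p)) s r)).
    apply: (@le_chain_sum R [pred x | a <= x <= b]) => // x y xab yab.
    rewrite /small_diff pE powRr1//; case: ifP => [xy|_]; last first.
      by rewrite mulr_ge0//; lra.
    have [_ ->] := incr _ _ _ xab yab xy; rewrite mulrC ler_wpM2r//.
    have /andP[fd gd] := xy; rewrite (le_trans (ler_normD _ _))//; lra.
  rewrite chain_sumZ; have hs := hM _ _ _ as_ tb rst.
  apply: (@le_trans _ _ (2 * d * (Mh + 1))); first by rewrite ler_pM2l; lra.
  have -> // : 2 * d * (Mh + 1) = e.
  by rewrite /d; field; rewrite gt_eqF//; lra.
have [Mg Mg0 gM] := Wp_chain_sum ab gq.
have p0 : 0 < p by lra.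
(* e' is what the bound 2 e' |dg|^q + 4 e' |dh|^p, summed, requires *)
pose e' := e / (2 * Mg + 4 * Mh + 1).
have e'0 : 0 < e' by rewrite divr_gt0//; lra.
rewrite addrC in pq.
have pp : 1 < p^-1 + p^-1.
  have : 2^-1 < p^-1 by rewrite ltf_pV2 ?posrE.
  by lra.
have [d1 d10 gh_le] := product_le_powers q0 p0 pq e'0.
have [d2 d20 hh_le] := product_le_powers p0 p0 pp e'0.
(* the halving makes room for the increments of h, which are bounded by 2 d *)
pose d := Num.min d1 d2 / 2.
have d0 : 0 < d by rewrite divr_gt0// lt_min d10.
have [dd1 dd2] : 2 * d <= d1 /\ 2 * d <= d2.
  by rewrite /d mulrC divfK// !ge_min !lexx orbT.
exists d => // s t r as_ tb rst.
have [sab rab] := in_ab _ _ _ as_ tb rst.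
apply: (@le_trans _ _ (chain_sum (fun x y =>
  (2 * e') * (`|g y - g x| `^ q) + (4 * e') * (`|h y - h x| `^ p)) s r)).
  apply: (@le_chain_sum R [pred x | a <= x <= b]) => // x y xab yab.
  rewrite /small_diff; case: ifP => [xy|_]; last first.
    by rewrite addr_ge0// mulr_ge0 ?powR_ge0//; lra.
  have [hd ->] := incr _ _ _ xab yab xy.
  have gd : `|g y - g x| <= d by case/andP: xy.
  have fgh : `|(f y - f x) + (g y - g x)| <= 2 * `|g y - g x| + `|h y - h x|.
    rewrite (fE _ xab) (fE _ yab); apply: le_trans (_ : _ <= `|2 * (g y - g x) + (h y - h x)|) _.
      by rewrite le_eqVlt; apply/orP; left; apply/eqP; congr (`|_|); ring.
    by rewrite (le_trans (ler_normD _ _))// normrM ger0_norm.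
  apply: le_trans (ler_wpM2l (normr_ge0 _) fgh) _.
  have hd1 : `|h y - h x| <= d1 by lra. have hd2 : `|h y - h x| <= d2 by lra.
  have gd1 : `|g y - g x| <= d1 by lra.
  have := gh_le _ _ gd1 hd1; have := hh_le _ _ hd2 hd2; lra.
rewrite chain_sumD !chain_sumZ.
have gs := gM _ _ _ as_ tb rst; have hs := hM _ _ _ as_ tb rst.
apply: (@le_trans _ _ (e' * (2 * Mg + 4 * Mh + 1))); last first.
  by rewrite /e' divfK// gt_eqF//; lra.
have := ler_wpM2l (ltW e'0) gs; have := ler_wpM2l (ltW e'0) hs; lra.
Qed.

End VariationDuality.

(** * Decomposable functions *)

Section Jumps.
Context {R : realType} (a b : R) (f g h : R -> R) (C : R).
Hypotheses (regg : regulated a b g) (regh : regulated a b h).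
Hypothesis fE : forall t, a <= t <= b -> f t = C + g t + h t.

Lemma jumpr_decomp s : a <= s < b -> jumpr f s = jumpr g s + jumpr h s.
Proof.
move=> sab; have /andP[as_ sb] := sab; rewrite /jumpr.
have -> : rlim f s = C + rlim g s + rlim h s.
  apply: cvg_lim => //.
  have lim : C + g u + h u @[u --> s^'+] --> C + rlim g s + rlim h s.
    apply: cvgD; last exact: (regulated_right regh sab).
    by apply: cvgD; [exact: cvg_cst|exact: (regulated_right regg sab)].
  apply: cvg_trans lim; apply: near_eq_cvg; near=> u.
  rewrite fE//; apply/andP; split.
    by apply: le_trans as_ _; apply: ltW; near: u; exact: nbhs_right_gt.
  by apply: ltW; near: u; exact: nbhs_right_lt.
rewrite fE ?as_ ?ltW//; lra.
Unshelve. all: by end_near. Qed.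

Lemma jumpl_decomp t : a < t <= b -> jumpl f t = jumpl g t + jumpl h t.
Proof.
move=> tab; have /andP[at_ tb] := tab; rewrite /jumpl.
have -> : llim f t = C + llim g t + llim h t.
  apply: cvg_lim => //.
  have lim : C + g u + h u @[u --> t^'-] --> C + llim g t + llim h t.
    apply: cvgD; last exact: (regulated_left regh tab).
    by apply: cvgD; [exact: cvg_cst|exact: (regulated_left regg tab)].
  apply: cvg_trans lim; apply: near_eq_cvg; near=> u.
  rewrite fE//; apply/andP; split.
    by apply: ltW; near: u; exact: nbhs_left_gt.
  by apply: le_trans tb; apply: ltW; near: u; exact: nbhs_left_lt.
rewrite fE ?tb ?ltW//; lra.
Unshelve. all: by end_near. Qed.

End Jumps.

Lemma fin_num_summands {R : realType} (x y : \bar R) :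
  (0 <= x)%E -> (0 <= y)%E -> (x + y < +oo)%E ->
  x \is a fin_num /\ y \is a fin_num.
Proof. by case: x => [x||]; case: y => [y||]. Qed.

Theorem corollary16 (R : realType) (a b : R) (lambda : nat -> seq R) (p : R)
    (f g h : R -> R) :
  a < b -> Lambda a b lambda -> 1 <= p < 2 ->
  decomposable a b lambda p f ->
  (Dplus a b lambda p f `|` Dminus a b lambda p f) (g, h) ->
  Qvar a b lambda f /\
  (forall x : R, a <= x <= b ->
    ((bracket a b lambda f x)%:E =
     bracket_cont a b lambda g x
       + sum_jumpl_sqr f a x + sum_jumpr_sqr f a x)%E).
Proof.
move=> ab lamL p12 [regf _] gh.
have gh_pair : Dpairs a b lambda p f (g, h) by case: gh => -[].
have [[regg regh] [[_ [V gV]] gdual] hp _ fgh] := gh_pair.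
have [C fE] := fgh.
have negl := decomposable_negligible ab p12 gdual hp fgh.
have g_fin s t := @bracket_jump_sum R a b lambda g V s t gV.
have f_fin := jump_sum_finite regf regg negl g_fin.
have cut u : a < u < b -> points lambda a u \/
    (jumpr f u = 0 /\ jumpr g u = 0) \/ (jumpl f u = 0 /\ jumpl g u = 0).
  move=> uab; have /andP[au ub] := uab.
  have [?|up] := pselect (points lambda a u); [by left|right].
  case: gh => -[_ /= sub]; [left|right].
    have r0 k : (k = g \/ k = h) -> jumpr k u = 0.
      move=> kgh; apply: contrapT => /eqP ku; apply: up; apply: sub.
      by case: kgh => <-; [left|right].
    rewrite (jumpr_decomp regg regh fE); last by rewrite ltW.
    by rewrite !r0 ?addr0; [split|right|left].
  have l0 k : (k = g \/ k = h) -> jumpl k u = 0.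
    move=> kgh; apply: contrapT => /eqP ku; apply: up; apply: sub.
    by case: kgh => <-; [left|right].
  rewrite (jumpl_decomp regg regh fE); last by rewrite au ltW.
  by rewrite !l0 ?addr0; [split|right|left].
have fV := is_bracket_comparison regf regg negl g_fin lamL cut gV.
split; first by split=> //; eexists; exact: fV.
move=> x xab; rewrite (bracketE fV xab) /bracket_cont (bracketE gV xab) /=.
rewrite /jump_correction.
have sum_lty k : (forall s t, a <= s -> s < t -> t <= b -> (jump_sum k s t < +oo)%E) ->
    sum_jumpl_sqr k a x \is a fin_num /\ sum_jumpr_sqr k a x \is a fin_num.
  move=> k_fin; apply: fin_num_summands.
  - by apply: esum_ge0 => y _; rewrite lee_fin sqr_ge0.
  - by apply: esum_ge0 => y _; rewrite lee_fin sqr_ge0.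
  have /andP[+ xb] := xab; rewrite le_eqVlt => /predU1P[<-|ax].
    by rewrite sum_jumps_nil ltry.
  by rewrite sum_jumpsE// k_fin.
have [/fineK <- /fineK <-] := sum_lty _ f_fin.
have [/fineK <- /fineK <-] := sum_lty _ g_fin.
rewrite -!EFinN -!EFinD /=; congr EFin; lra.
Qed.
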